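(* For every prime power $q$, the number $I_{\mathrm{GH}}(q)$ of $\mathbb{F}_q$-isomorphism classes of generalized Hessian curves over $\mathbb{F}_q$ is $\lfloor 3(q+3)/4\rfloor$ if $q\equiv1\pmod3$, and $q-1$ if $q\equiv0,2\pmod3$.
   Context: For $u,v\in\mathbb{F}_q$ with $v\ne0$ and $u^3\ne27v$, the generalized Hessian curve $E_{\mathrm{GH},u,v}$ is the elliptic curve $X^3+Y^3+v=uXY$ over $\mathbb{F}_q$. Two such curves are $\mathbb{F}_q$-isomorphic if they are birationally equivalent over $\mathbb{F}_q$ (equivalently, their Weierstrass models are isomorphic via a Weierstrass change of variables $X\mapsto\alpha^2\tilde X+\beta$, $Y\mapsto\alpha^3\tilde Y+\alpha^2\gamma\tilde X+\delta$ with $\alpha,\beta,\gamma,\delta\in\mathbb{F}_q$, $\alpha\ne0$). $I_{\mathrm{GH}}(q)$ is the number of equivalence classes of $\{E_{\mathrm{GH},u,v}: u,v\in\mathbb{F}_q,\ v\ne0,\ u^3\ne27v\}$ under $\mathbb{F}_q$-isomorphism. *)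

(* Defs.v *)
From HB Require Import structures.
From mathcomp Require Import all_boot all_order all_algebra all_fingroup all_field.
Set Implicit Arguments. Unset Strict Implicit. Unset Printing Implicit Defensive.
Import GRing.Theory.
Local Open Scope ring_scope.

(* Long Weierstrass coefficients (a1, a2, a3, a4, a6) of
   y^2 + a1 x y + a3 y = x^3 + a2 x^2 + a4 x + a6. *)
Record wcoef (F : Type) := WCoef { a1 : F; a2 : F; a3 : F; a4 : F; a6 : F }.

(* E' is obtained from E by the Weierstrass change of variables
   X = al^2 X' + be,  Y = al^3 Y' + al^2 ga X' + de  (al <> 0),
   i.e. the standard transformation formulas (Silverman, Table 3.1). *)
Definition wchange (F : fieldType) (E E' : wcoef F) (al be ga de : F) : bool :=
  [&& al != 0,
      al * a1 E' == a1 E + 2%:R * ga,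
      al ^+ 2 * a2 E' == a2 E - ga * a1 E + 3%:R * be - ga ^+ 2,
      al ^+ 3 * a3 E' == a3 E + be * a1 E + 2%:R * de,
      al ^+ 4 * a4 E' == a4 E - ga * a3 E + 2%:R * be * a2 E
                         - (de + be * ga) * a1 E + 3%:R * be ^+ 2 - 2%:R * ga * de
   & al ^+ 6 * a6 E' == a6 E + be * a4 E + be ^+ 2 * a2 E + be ^+ 3
                         - de * a3 E - de ^+ 2 - be * de * a1 E].

Definition wiso (F : finFieldType) (E E' : wcoef F) : bool :=
  [exists al : F, exists be : F, exists ga : F, exists de : F,
     wchange E E' al be ga de].

(* Weierstrass model of the generalized Hessian curve X^3 + Y^3 + v = u X Y,
   obtained by an invertible projective linear change of coordinates
   (valid in every characteristic when v <> 0 and u^3 <> 27 v):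
   y^2 + u x y + 9 v y = x^3 - 9 u v x - v (u^3 + 27 v). *)
Definition GH_W (F : fieldType) (u v : F) : wcoef F :=
  WCoef u 0 (9%:R * v) (- (9%:R * u * v)) (- (v * (u ^+ 3 + 27%:R * v))).

Definition GH_params (F : finFieldType) : {set F * F} :=
  [set p : F * F | (p.2 != 0) && (p.1 ^+ 3 != 27%:R * p.2)].

Definition GH_iso (F : finFieldType) (p p' : F * F) : bool :=
  wiso (GH_W p.1 p.2) (GH_W p'.1 p'.2).

Definition I_GH (F : finFieldType) : nat :=
  #|[set [set p' in GH_params F | GH_iso p p'] | p in GH_params F]|.

(* Main.v *)
Require Import Defs.
From mathcomp Require Import all_boot all_order all_algebra all_fingroup all_field.
From mathcomp Require Import ring zify.
Set Implicit Arguments. Unset Strict Implicit. Unset Printing Implicit Defensive.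
Import GRing.Theory.
Local Open Scope ring_scope.

(** A change of variables between generalized Hessian curves either preserves the
    distinguished rational subgroup of order 3, in which case it is, up to sign, a scaling
    (u, v) -> (u/c, v/c^3), or it moves that subgroup to another rational one.  The second
    possibility needs a primitive cube root of unity in the field and v to be a cube.
    So if q = 0, 2 mod 3 the ratio v/u^3 is a complete invariant, with q - 1 values.  If
    q = 3m + 1, the 2m noncubes v contribute 2m classes with u <> 0 and 2 with u = 0.  For v
    a cube the curve is a Hessian curve x^3 + y^3 + 1 = 3 d x y and the j-invariant is a
    complete invariant: as a function of d it has degree 12, invariant under d -> w d and
    d -> (d + 2)/(d - 1), so the q - 3 smooth parameters d fall into fibres of size 12
    except for those over j = 0 and j = 1728. *)

(** * Weierstrass quantities and their behaviour under changes of variables *)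

Section WeierstrassInvariants.
Variable F : fieldType.
Implicit Types (E : wcoef F).

Definition wb2 E := a1 E ^+ 2 + 4%:R * a2 E.
Definition wb4 E := 2%:R * a4 E + a1 E * a3 E.
Definition wb6 E := a3 E ^+ 2 + 4%:R * a6 E.
(** Expanded as a polynomial instead of [(b2 b6 - b4^2) / 4], so that it makes sense in
    characteristic 2. *)
Definition wb8 E := a1 E ^+ 2 * a6 E + 4%:R * a2 E * a6 E - a1 E * a3 E * a4 E
                    + a2 E * a3 E ^+ 2 - a4 E ^+ 2.
Definition wc4 E := wb2 E ^+ 2 - 24%:R * wb4 E.
Definition wdisc E := - wb2 E ^+ 2 * wb8 E - 8%:R * wb4 E ^+ 3
                      - 27%:R * wb6 E ^+ 2 + 9%:R * wb2 E * wb4 E * wb6 E.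

(** A change of variables is an equality between a scaling of the target and a shift (the case
    [al = 1]) of the source. Invariance then amounts to homogeneity under [wscale] and invariance
    under [wshift]. *)
Definition wscale (al : F) E :=
  WCoef (al * a1 E) (al ^+ 2 * a2 E) (al ^+ 3 * a3 E) (al ^+ 4 * a4 E) (al ^+ 6 * a6 E).

Definition wshift E (be ga de : F) := WCoef
  (a1 E + 2%:R * ga) (a2 E - ga * a1 E + 3%:R * be - ga ^+ 2)
  (a3 E + be * a1 E + 2%:R * de)
  (a4 E - ga * a3 E + 2%:R * be * a2 E - (de + be * ga) * a1 E
     + 3%:R * be ^+ 2 - 2%:R * ga * de)
  (a6 E + be * a4 E + be ^+ 2 * a2 E + be ^+ 3 - de * a3 E - de ^+ 2 - be * de * a1 E).

Lemma wchangeP E E' al be ga de :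
  reflect (al != 0 /\ wscale al E' = wshift E be ga de) (wchange E E' al be ga de).
Proof.
apply: (iffP idP).
  case/and5P=> al0 /eqP h1 /eqP h2 /eqP h3 /andP[/eqP h4 /eqP h6].
  by split; rewrite // /wscale /wshift h1 h2 h3 h4 h6.
case=> al0 [h1 h2 h3 h4 h6].
by rewrite /wchange al0 h1 h2 h3 h4 h6 !eqxx.
Qed.

Lemma wb_shift E be ga de (E' := wshift E be ga de) :
  [/\ wb2 E' = wb2 E + 12%:R * be,
      wb4 E' = wb4 E + be * wb2 E + 6%:R * be ^+ 2,
      wb6 E' = wb6 E + 2%:R * be * wb4 E + be ^+ 2 * wb2 E + 4%:R * be ^+ 3
    & wb8 E' = wb8 E + 3%:R * be * wb6 E + 3%:R * be ^+ 2 * wb4 E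
               + be ^+ 3 * wb2 E + 3%:R * be ^+ 4].
Proof. by rewrite /E' /wb2 /wb4 /wb6 /wb8 /=; split; ring. Qed.

Lemma wchange_c4 E E' al be ga de :
  wchange E E' al be ga de -> al ^+ 4 * wc4 E' = wc4 E.
Proof.
case/wchangeP=> _ eqE.
have -> : al ^+ 4 * wc4 E' = wc4 (wscale al E').
  by rewrite /wc4 /wb2 /wb4 /=; ring.
by rewrite eqE /wc4; have [-> -> _ _] := wb_shift E be ga de; ring.
Qed.

Lemma wchange_disc E E' al be ga de :
  wchange E E' al be ga de -> al ^+ 12 * wdisc E' = wdisc E.
Proof.
case/wchangeP=> _ eqE.
have -> : al ^+ 12 * wdisc E' = wdisc (wscale al E').
  by rewrite /wdisc /wb2 /wb4 /wb6 /wb8 /=; ring.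
by rewrite eqE /wdisc /wshift /wb2 /wb4 /wb6 /wb8 /=; ring.
Qed.

(** The parameters are read off from [X' = (X - be) / al^2] and
    [Y' = (Y - ga (X - be) - de) / al^3]. *)
Lemma wchange_inv E E' al be ga de : wchange E E' al be ga de ->
  wchange E' E al^-1 (- be / al ^+ 2) (- ga / al) ((be * ga - de) / al ^+ 3).
Proof.
case/wchangeP=> al0 [h1 h2 h3 h4 h6]; apply/wchangeP; split; first by rewrite invr_eq0.
have e1 : a1 E' = (a1 E + 2%:R * ga) / al by rewrite -h1; field.
have e2 : a2 E' = (a2 E - ga * a1 E + 3%:R * be - ga ^+ 2) / al ^+ 2.
  by rewrite -h2; field.
have e3 : a3 E' = (a3 E + be * a1 E + 2%:R * de) / al ^+ 3 by rewrite -h3; field.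
have /(canRL (mulKf (expf_neq0 4 al0))) e4 := h4.
have /(canRL (mulKf (expf_neq0 6 al0))) e6 := h6.
by rewrite /wscale /wshift e1 e2 e3 e4 e6; congr WCoef; field.
Qed.

End WeierstrassInvariants.

(** * Classification of the changes of variables between generalized Hessian curves *)

Section GeneralizedHessian.
Variable F : fieldType.
Implicit Types (u v al be ga de : F).

Lemma GH_c4 u v : wc4 (GH_W u v) = u * (u ^+ 3 + 216%:R * v).
Proof. by rewrite /wc4 /wb2 /wb4 /=; ring. Qed.

Lemma GH_disc u v : wdisc (GH_W u v) = v * (u ^+ 3 - 27%:R * v) ^+ 3.
Proof. by rewrite /wdisc /wb2 /wb4 /wb6 /wb8 /=; ring. Qed.

(** The j-invariant [c4^3 / disc]. *)
Definition GH_j u v :=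
  u ^+ 3 * (u ^+ 3 + 216%:R * v) ^+ 3 / (v * (u ^+ 3 - 27%:R * v) ^+ 3).

Lemma wchange_GH_j u v u' v' al be ga de :
  wchange (GH_W u v) (GH_W u' v') al be ga de -> GH_j u v = GH_j u' v'.
Proof.
move=> chg; have [al0 _] := wchangeP _ _ _ _ _ _ chg.
have c4 := wchange_c4 chg; have disc := wchange_disc chg.
rewrite !GH_c4 in c4; rewrite !GH_disc in disc.
by rewrite /GH_j -disc -!exprMn -c4 (exprMn 3 (al ^+ 4)) -exprM -mulf_div divff ?mul1r // expf_neq0.
Qed.

Lemma wchange_GH_scale u v u' v' al :
  al != 0 -> u = al * u' -> v = al ^+ 3 * v' ->
  wchange (GH_W u v) (GH_W u' v') al 0 0 0.
Proof.
by move=> al0 -> ->; apply/wchangeP; split; rewrite // /wscale /wshift /=; congr WCoef; ring.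
Qed.

Hypothesis three_neq0 : 3%:R != 0 :> F.

(* On the Hessian cubic x^3 + y^3 + z^3 = 3 d x y z, an order 3 subgroup other than
   the one at infinity gives d -> (d + 2) / (d - 1); here d = y / b. *)
Lemma wchange_GH_hessian (w y u' b b' : F) :
  w ^+ 2 + w + 1 = 0 -> b' != 0 -> y != b ->
  u' * (y - b) = 3%:R * b' * (y + 2%:R * b) ->
  exists al be ga de,
    wchange (GH_W (3%:R * y) (b ^+ 3)) (GH_W u' (b' ^+ 3)) al be ga de.
Proof.
move=> w2 b'0 yb eqU.
have ew : w ^+ 2 = - w - 1 by apply/eqP; rewrite -subr_eq0; apply/eqP; rewrite -w2; ring.
(* A square root of -3. *)
pose th := 1 + 2%:R * w.
have th0 : th != 0.
  by rewrite -sqrf_eq0 (_ : th ^+ 2 = - 3%:R) ?oppr_eq0 // /th; ring: ew.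
pose al := - (y - b) * th / (3%:R * b').
pose V := (y - b) ^+ 3 * th / 9%:R.
(* [ga] is chosen so that [3 y + 2 ga = - th (y + 2 b)], which equals [al u']. The [a2] equation
   [3 be = ga (3 y + ga)] then forces [be]. *)
exists al, (- (b ^+ 2 + b * y + y ^+ 2)), (- th * b - (2%:R + w) * y),
  ((2%:R + w) * y ^+ 3 - 3%:R * w * y ^+ 2 * b + 3%:R * (1 + w) * y * b ^+ 2
   - (5%:R + w) * b ^+ 3).
have n9 : 9%:R != 0 :> F by rewrite (_ : 9 = 3 * 3)%N // natrM mulf_neq0.
have n27 : 27%:R != 0 :> F by rewrite (_ : 27 = 3 * 9)%N // natrM mulf_neq0.
have th3 : th ^+ 3 = - 3%:R * th by rewrite /th; ring: ew.
have au : al * u' = - th * (y + 2%:R * b).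
  transitivity (- (u' * (y - b)) * th / (3%:R * b'));
    first by rewrite /al; field; rewrite b'0 three_neq0.
  by rewrite eqU; field; rewrite b'0 three_neq0.
have av : al ^+ 3 * b' ^+ 3 = V.
  transitivity (- (y - b) ^+ 3 * th ^+ 3 / 27%:R).
    by rewrite /al; field; rewrite ?b'0 ?n27 ?three_neq0.
  by rewrite th3 /V; field; rewrite ?n27 ?n9.
have V9 : 9%:R * V = (y - b) ^+ 3 * th by rewrite /V; field; rewrite n9.
have V2 : 27%:R * V ^+ 2 = - (y - b) ^+ 6.
  transitivity ((y - b) ^+ 6 * th ^+ 2 / 3%:R); first by rewrite /V; field; rewrite ?n9 ?three_neq0.
  rewrite (_ : th ^+ 2 = - 3%:R); last by rewrite /th; ring: ew.
  by field; rewrite three_neq0.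
apply/wchangeP; split.
  by rewrite /al !mulf_neq0 ?oppr_eq0 ?subr_eq0 // invr_eq0 mulf_neq0.
rewrite /wscale /wshift /=; congr WCoef.
- by rewrite au /th; ring.
- by rewrite /th; ring: ew.
- rewrite mulrCA av V9 /th; ring: ew.
- transitivity (- (9%:R * (al ^+ 3 * b' ^+ 3)) * (al * u')); first by ring.
  by rewrite av au V9 /th; ring: ew.
- transitivity (- (al ^+ 3 * b' ^+ 3 * (al * u') ^+ 3) - 27%:R * (al ^+ 3 * b' ^+ 3) ^+ 2).
    by ring.
  rewrite av au V2.
  have -> : V * (- th * (y + 2%:R * b)) ^+ 3 = (y + 2%:R * b) ^+ 3 * th * (3%:R * V).
    by rewrite exprMn exprNn th3; ring.
  have -> : 3%:R * V = (y - b) ^+ 3 * th / 3%:R by rewrite /V; field; rewrite ?n9 three_neq0.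
  have -> : (y + 2%:R * b) ^+ 3 * th * ((y - b) ^+ 3 * th / 3%:R)
      = - ((y + 2%:R * b) ^+ 3 * (y - b) ^+ 3).
    rewrite (_ : _ * _ = th ^+ 2 / 3%:R * ((y + 2%:R * b) ^+ 3 * (y - b) ^+ 3)); last by ring.
    rewrite (_ : th ^+ 2 = - 3%:R); last by rewrite /th; ring: ew.
    by rewrite mulNr divff // mulN1r.
  rewrite /th; ring: ew.
Qed.

(* In the third case A^2 - A B + B^2 is the norm (over a primitive cube root of unity w)
   of (ga + w U)^3 - 27 v; in the last one -3 is a square. *)
Lemma wchange_GH_cases u v u' v' al be ga de (U := al * u') (V := al ^+ 3 * v') 
    (A := ga ^+ 3 + U ^+ 3 - 3%:R * ga * U ^+ 2 - 27%:R * v)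
    (B := 3%:R * ga * U * (ga - U)) :
  wchange (GH_W u v) (GH_W u' v') al be ga de ->
  [\/ U = u /\ V = v, U = - u /\ V = - v,
      [/\ U = u + 2%:R * ga, ga * U * (u + ga) != 0 & A ^+ 2 - A * B + B ^+ 2 = 0]
    | [/\ U = 0, ga ^+ 3 = 27%:R * v, u = - 2%:R * ga & V ^+ 2 = - 27%:R * v ^+ 2]].
Proof.
case/wchangeP=> al0 [h1 h2 h3 h4 h6].
have n9 : 9%:R != 0 :> F by rewrite (_ : 9 = 3 * 3)%N // natrM mulf_neq0.
have n27 : 27%:R != 0 :> F by rewrite (_ : 27 = 3 * 9)%N // natrM mulf_neq0.
have eU : u + 2%:R * ga = U by rewrite -h1.
have {h2}ebe : be = ga * (u + ga) / 3%:R.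
  have -> : ga * (u + ga) = 3%:R * be.
    by apply/eqP; rewrite -subr_eq0 -oppr_eq0 -(mulr0 (al ^+ 2)) h2; apply/eqP; ring.
  by field.
have {}h3 : 9%:R * V = 9%:R * v + be * u + 2%:R * de by rewrite -h3 /V; ring.
have {}h4 : - (9%:R * V * U) = - (9%:R * u * v) - ga * (9%:R * v) - (de + be * ga) * u
              + 3%:R * be ^+ 2 - 2%:R * ga * de.
  by transitivity (al ^+ 4 * - (9%:R * u' * v')); [rewrite /U /V; ring | rewrite h4; ring].
have {}h6 : - (V * (U ^+ 3 + 27%:R * V)) = - (v * (u ^+ 3 + 27%:R * v))
    + be * - (9%:R * u * v) + be ^+ 3 - de * (9%:R * v) - de ^+ 2 - be * de * u.
  by transitivity (al ^+ 6 * - (v' * (u' ^+ 3 + 27%:R * v')));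
    [rewrite /U /V; ring | rewrite h6; ring].
(* [U] times the [a3] equation plus the [a4] equation eliminates [V] and leaves a relation linear in
   [de]. *)
have ede : de * U = - (9%:R * ga * v) - be * (u + ga) ^+ 2.
  apply/eqP; rewrite -subr_eq0.
  have -> : de * U - (- (9%:R * ga * v) - be * (u + ga) ^+ 2) =
     (9%:R * v + be * u + 2%:R * de) * U + (- (9%:R * u * v) - ga * (9%:R * v) - (de + be * ga) * u
              + 3%:R * be ^+ 2 - 2%:R * ga * de).
    by rewrite -eU ebe; field.
  by rewrite -h3 -h4 addrN.
have [U0|U0] := eqVneq U 0.
  have eu : u = - 2%:R * ga by apply/eqP; rewrite -subr_eq0 -U0 -eU; apply/eqP; ring.
  have e27 : ga * (ga ^+ 3 - 27%:R * v) = 0.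
    have -> : ga * (ga ^+ 3 - 27%:R * v) = 3%:R * (- (9%:R * ga * v) - be * (u + ga) ^+ 2).
      by rewrite ebe eu; field.
    by rewrite -ede U0 !mulr0.
  move/eqP: e27; rewrite mulf_eq0 subr_eq0 => /orP[/eqP g0|/eqP g3].
    have u0 : u = 0 by rewrite eu g0 mulr0.
    have b0 : be = 0 by rewrite ebe g0 mul0r mul0r.
    (* The [a6] equation is quadratic in [de]. The [a3] equation, multiplied by a conjugate factor
       to form a difference of squares, eliminates [de]. *)
    have : 27%:R * ((V - v) * (V + v)) = 0.
      have -> : 27%:R * ((V - v) * (V + v)) =
        - 4%:R * (- (V * (U ^+ 3 + 27%:R * V)) - (- (v * (u ^+ 3 + 27%:R * v))
    + be * - (9%:R * u * v) + be ^+ 3 - de * (9%:R * v) - de ^+ 2 - be * de * u))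
       - (9%:R * V + 9%:R * v + 2%:R * de) * (9%:R * V - (9%:R * v + be * u + 2%:R * de)).
        by rewrite U0 u0 b0; ring.
      by rewrite -h3 -h6 !subrr !mulr0 subr0.
    move/eqP; rewrite !mulf_eq0 (negPf n27) subr_eq0 addr_eq0 U0 u0 /= => /orP[]/eqP->.
      by apply: Or41.
    by apply: Or42; rewrite oppr0.
  apply: Or44; split=> //.
  apply/eqP; rewrite -subr_eq0; suff /eqP: 27%:R * (V ^+ 2 - - 27%:R * v ^+ 2) = 0.
    by rewrite mulf_eq0 (negPf n27).
  have b0 : be = - (ga ^+ 2) / 3%:R by rewrite ebe eu; field.
  have -> : 27%:R * (V ^+ 2 - - 27%:R * v ^+ 2) =
        - 4%:R * (- (V * (U ^+ 3 + 27%:R * V)) - (- (v * (u ^+ 3 + 27%:R * v))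
    + be * - (9%:R * u * v) + be ^+ 3 - de * (9%:R * v) - de ^+ 2 - be * de * u))
       - (9%:R * V + 27%:R * v + 2%:R * de) * (9%:R * V - (9%:R * v + be * u + 2%:R * de)).
    rewrite U0 eu b0; have -> : v = ga ^+ 3 / 27%:R by rewrite g3; field.
    by field; rewrite n27 three_neq0.
  by rewrite -h3 -h6 !subrr !mulr0 subr0.
have {}ede : de = (- (9%:R * ga * v) - be * (u + ga) ^+ 2) / U by rewrite -ede mulfK.
have {}h3 : V = (9%:R * v + be * u + 2%:R * de) / 9%:R by rewrite -h3; field.
have [g0|g0] := eqVneq ga 0.
  have eq : U = u by rewrite -eU g0 mulr0 addr0.
  by apply: Or41; split; rewrite // h3 ede ebe g0; field; rewrite ?n9 U0 three_neq0.
have [w0|w0] := eqVneq (u + ga) 0.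
  have gu : ga = - u by apply/eqP; rewrite -addr_eq0 addrC w0.
  have eq : U = - u by rewrite -eU gu; ring.
  apply: Or42; split; rewrite // h3 ede ebe gu eq; field.
  by rewrite ?oppr_eq0 -[u == 0]oppr_eq0 -eq ?n9 U0 three_neq0.
apply: Or43; rewrite eU; split=> //.
  exact: mulf_neq0 (mulf_neq0 g0 U0) w0.
apply/eqP.
suff /eqP: ga * (u + ga) * (A ^+ 2 - A * B + B ^+ 2) = 0.
  by rewrite !mulf_eq0 (negPf g0) (negPf w0).
(* Once [be], [de] and [V] are expressed through [ga], [u] and [v], the [a6] equation factors. The
   factors [ga] and [u + ga] correspond to the two cases treated just above. *)
have -> : ga * (u + ga) * (A ^+ 2 - A * B + B ^+ 2) = 27%:R * U ^+ 2 *
     (- (V * (U ^+ 3 + 27%:R * V)) - (- (v * (u ^+ 3 + 27%:R * v))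
    + be * - (9%:R * u * v) + be ^+ 3 - de * (9%:R * v) - de ^+ 2 - be * de * u)).
  rewrite -eU in U0.
  by rewrite /A /B h3 ede ebe -eU; field; rewrite ?U0 ?n9 ?three_neq0.
by rewrite -h6 subrr mulr0.
Qed.

Definition GH_twist u v u' v' := exists c, [/\ c != 0, u = c * u' & v = c ^+ 3 * v'].

(** Without a primitive cube root of unity the form [A^2 - A B + B^2] is anisotropic, which excludes
    the third case. The fourth survives only when it is itself a scaling. Signs are absorbed by
    replacing [al] with [- al]. *)
Lemma wchange_GH_twist_irrational u v u' v' al be ga de :
  (forall w : F, w ^+ 2 + w + 1 != 0) ->
  wchange (GH_W u v) (GH_W u' v') al be ga de -> GH_twist u v u' v'.
Proof.
move=> no_w chg; have [al0 _] := wchangeP _ _ _ _ _ _ chg.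
have twist1 : al * u' = u -> al ^+ 3 * v' = v -> GH_twist u v u' v' by exists al.
have twistN : al * u' = - u -> al ^+ 3 * v' = - v -> GH_twist u v u' v'.
  move=> eu ev; exists (- al); rewrite oppr_eq0; split=> //.
    by rewrite mulNr eu opprK.
  by rewrite exprNn -signr_odd /= expr1 mulN1r mulNr ev opprK.
case: (wchange_GH_cases chg) => [[]|[]|[eU nz]|[eU g3 eu eV]] //.
- set U := al * u' in eU nz *.
  set A := (_ - 27%:R * v); set B := (3%:R * _ * _ * _) => eQ.
  have B0 : B != 0.
    have -> : B = - (3%:R * (ga * U * (u + ga))) by rewrite /B eU; ring.
    by rewrite oppr_eq0 mulf_neq0.
  have := no_w (- A / B).
  have -> : (- A / B) ^+ 2 + - A / B + 1 = (A ^+ 2 - A * B + B ^+ 2) / B ^+ 2 by field.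
  by rewrite eQ mul0r eqxx.
- set V := al ^+ 3 * v' in eV *.
  (* In characteristic 2 the element -3 is the square 1, so there is no contradiction: [V^2 = v^2]
     gives [V = v], and [u = - 2 ga = 0]. *)
  have [two0|two0] := eqVneq (2%:R : F) 0.
    have u0 : u = 0 by rewrite eu mulNr two0 mul0r oppr0.
    apply: twist1; rewrite ?u0 //; apply/eqP; rewrite -subr_eq0 -sqrf_eq0.
    have -> : (V - v) ^+ 2 = V ^+ 2 + 27%:R * v ^+ 2 - 2%:R * (13%:R * v ^+ 2 + V * v) by ring.
    by rewrite eV two0; apply/eqP; ring.
  have [v0|v0] := eqVneq v 0.
    have g0 : ga = 0 by apply/eqP; rewrite -[ga == 0](expf_eq0 _ 3) g3 v0 mulr0.
    apply: twist1; first by rewrite eU eu g0 mulr0.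
    by apply/eqP; rewrite v0 -sqrf_eq0 -/V eV v0; apply/eqP; ring.
  (* [V / (3 v)] is a square root [r] of -3, so [(r - 1) / 2] is a primitive cube root of unity. *)
  have := no_w ((V / (3%:R * v) - 1) / 2%:R).
  have -> : ((V / (3%:R * v) - 1) / 2%:R) ^+ 2 + (V / (3%:R * v) - 1) / 2%:R + 1
     = (V ^+ 2 + 27%:R * v ^+ 2) / (36%:R * v ^+ 2).
    have n36 : 36%:R != 0 :> F by rewrite (_ : 36 = 2 * 2 * 3 * 3)%N // !natrM !mulf_neq0.
    by field; rewrite v0 two0 three_neq0 n36.
  by rewrite eV mulNr addNr mul0r eqxx.
Qed.

(** Each case other than a scaling would exhibit [27 v], hence [v], as a cube: in the third one the
    norm splits over [w] into two factors of the form [x^3 - 27 v]. *)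
Lemma wchange_GH_twist_noncube (w u v u' v' al be ga de : F) :
  w ^+ 2 + w + 1 = 0 -> (forall b, v != b ^+ 3) ->
  wchange (GH_W u v) (GH_W u' v') al be ga de -> GH_twist u v u' v'.
Proof.
move=> w2 ncube chg; have [al0 _] := wchangeP _ _ _ _ _ _ chg.
have ew : w ^+ 2 = - w - 1 by apply/eqP; rewrite -subr_eq0; apply/eqP; rewrite -w2; ring.
have ncube27 b : b ^+ 3 != 27%:R * v.
  apply: contraNneq (ncube (b / 3%:R)) => eb; apply/eqP.
  have n27 : 27%:R != 0 :> F by rewrite (_ : 27 = 3 ^ 3)%N // natrX expf_neq0.
  transitivity (b ^+ 3 / 27%:R); last by field; rewrite n27 three_neq0.
  by rewrite eb; field.
case: (wchange_GH_cases chg) => [[eu ev]|[eu ev]|[eU _]|[_ g3 _ _]].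
- by exists al.
- exists (- al); rewrite oppr_eq0; split=> //; first by rewrite mulNr eu opprK.
  by rewrite exprNn -signr_odd /= expr1 mulN1r mulNr ev opprK.
- set U := al * u'; set A := (_ - 27%:R * v); set B := (3%:R * _ * _ * _) => eQ.
  have : ((ga + w * U) ^+ 3 - 27%:R * v) * ((ga - (1 + w) * U) ^+ 3 - 27%:R * v) = 0.
    rewrite -eQ /A /B; ring: ew.
  by move/eqP; rewrite mulf_eq0 !subr_eq0 !(negPf (ncube27 _)).
- by have := ncube27 ga; rewrite g3 eqxx.
Qed.

End GeneralizedHessian.

(** * Counting classes, fibres and images in finite sets *)

(** The class of [x] is the fibre of the complete invariant [h] through [x], and distinct values of
    [h] have distinct nonempty fibres. Counting classes thus becomes counting values. *)
Lemma card_classes (T X : finType) (D : {set T}) (R : rel T) (h : T -> X) :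
  {in D &, forall x y, R x y = (h x == h y)} ->
  #|[set [set y in D | R x y] | x in D]| = #|h @: D|.
Proof.
move=> hR; rewrite -(card_in_imset (f := fun z => [set y in D | z == h y])); last first.
  move=> _ z' /imsetP[x xD ->] _ /setP/(_ x).
  by rewrite !inE xD eqxx => /esym/eqP.
congr #|pred_of_set _|; rewrite -imset_comp; apply: eq_in_imset => x xD.
by apply/setP=> y; rewrite !inE; case yD: (y \in D); rewrite //= hR.
Qed.

Lemma card_uniform_fibres (T X : finType) (f : T -> X) (D : {set T}) n :
  {in D, forall x, #|[set y in D | f y == f x]| = n} -> #|D| = (#|f @: D| * n)%N.
Proof.
move=> fib; rewrite -sum1_card (partition_big_imset f) /= -sum_nat_const.
apply: eq_bigr => _ /imsetP[x xD ->]; rewrite -(fib x xD) -sum1_card.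
by apply: eq_bigl => y; rewrite inE.
Qed.

Lemma card_imset_preimID (T X : finType) (f : T -> X) (D : {set T}) (B : {set X}) :
  #|f @: D| = (#|f @: [set x in D | f x \in B]| + #|f @: [set x in D | f x \notin B]|)%N.
Proof.
rewrite -(cardsID B (f @: D)); congr (_ + _)%N; apply: eq_card => y.
  rewrite inE; apply/andP/imsetP => [[/imsetP[x xD ->] fB]|[x]].
    by exists x; rewrite // inE xD.
  by rewrite inE => /andP[xD fB] ->; rewrite imset_f.
rewrite inE; apply/andP/imsetP => [[fB /imsetP[x xD e]]|[x]].
  by exists x; rewrite // inE xD -e.
by rewrite inE => /andP[xD fB] ->; rewrite imset_f.
Qed.

(** * Cubes and cube roots of unity in a finite field *)

Section FiniteFieldCubes.
Variable F : finFieldType.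
Implicit Types x y w : F.

(** The cardinal is a power of the characteristic, so 3 divides it exactly in characteristic 3. *)
Lemma card_mod3_eq0 : (#|F| %% 3 == 0)%N = (3%:R == 0 :> F).
Proof.
have card_p p : p \in [pchar F] -> #|F| = (p ^ logn p #|F|)%N := @card_pprimeChar p F.
apply/eqP/eqP => [q3|F3].
  have [p p_pr charFp] := finPcharP F.
  have : (3 %| p ^ logn p #|F|)%N by rewrite -card_p // /dvdn q3.
  rewrite Euclid_dvdX // => /andP[]; rewrite dvdn_prime2 // => /eqP p3 _.
  by apply/eqP; have /andP[] := charFp; rewrite -p3.
have charF3 : 3 \in [pchar F] by rewrite inE /= F3 eqxx.
have := finNzRing_gt1 F; rewrite (card_p _ charF3).
by case: (logn _ _) => // n _; rewrite expnS modnMr.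
Qed.

Lemma expf_card_pred x : x != 0 -> x ^+ #|F|.-1 = 1.
Proof.
move=> x0; apply: (mulfI x0); rewrite mulr1 -exprS prednK ?expf_card //.
exact: ltnW (finNzRing_gt1 F).
Qed.

Lemma omega_cube w : w ^+ 2 + w + 1 = 0 -> w ^+ 3 = 1.
Proof.
move=> w2; apply/eqP; rewrite -subr_eq0.
by have -> : w ^+ 3 - 1 = (w - 1) * (w ^+ 2 + w + 1); [ring | rewrite w2 mulr0].
Qed.

(** Here [q - 1] is 1 modulo 3, so [w^3 = 1] and [w^(q - 1) = 1] force [w = 1], and then [3 = 0]. *)
Lemma no_omega : (#|F| %% 3 = 2)%N -> forall w, w ^+ 2 + w + 1 != 0.
Proof.
move=> q2 w; apply/eqP => w2; have w3 := omega_cube w2.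
have w0 : w != 0 by apply: contra_eq_neq w3 => ->; rewrite expr0n eq_sym oner_eq0.
have := expf_card_pred w0.
have -> : #|F|.-1 = (3 * (#|F| %/ 3) + 1)%N by lia.
rewrite exprD exprM w3 expr1n mul1r expr1 => w1.
have /eqP : 3%:R = 0 :> F by rewrite -w2 w1; ring.
by rewrite -card_mod3_eq0 q2.
Qed.

Lemma card_root_lt (p : {poly F}) : p != 0 -> (#|[set x | root p x]| < size p)%N.
Proof.
move=> p0; rewrite cardE; apply: max_poly_roots; rewrite ?enum_uniq //.
by apply/allP => x; rewrite mem_enum inE.
Qed.

Lemma card_expr_eq (m : nat) (a : F) : (0 < m)%N -> (#|[set x : F | (x ^+ m == a)%R]| <= m)%N.
Proof.
move=> m0; have sz := size_XnsubC a m0.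
have p0 : 'X^m - a%:P != 0 by rewrite -size_poly_eq0 sz.
have := card_root_lt p0; rewrite sz ltnS; apply: leq_trans; apply: eq_leq.
by apply: eq_card => x; rewrite !inE rootE !hornerE subr_eq0.
Qed.

(** With [m = (q - 1) / 3], the equation [x^m = 1] has at most [m < q - 1] solutions. Any other
    nonzero [x] yields the primitive cube root of unity [x^m]. *)
Lemma exists_omega : (#|F| %% 3 = 1)%N -> exists w, w ^+ 2 + w + 1 = 0.
Proof.
move=> q1; have q_gt1 : (1 < #|F|)%N := finNzRing_gt1 F.
pose m := (#|F| %/ 3)%N; have m0 : (0 < m)%N by rewrite /m; lia.
have card0 : #|[set~ (0 : F)]| = #|F|.-1 := cardsC1 _.
have : ~~ ([set~ 0] \subset [set x : F | (x ^+ m == 1)%R]).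
  apply: contraL (card_expr_eq 1 m0) => /subset_leq_card.
  by rewrite card0 -ltnNge => /(leq_trans _); apply; rewrite /m; lia.
case/subsetPn=> x; rewrite !inE => x0 xm; exists (x ^+ m).
have /eqP : (x ^+ m - 1) * ((x ^+ m) ^+ 2 + x ^+ m + 1) = 0.
  transitivity ((x ^+ m) ^+ 3 - 1); first by ring.
  rewrite -exprM (_ : (m * 3)%N = #|F|.-1); last by rewrite /m; lia.
  by rewrite expf_card_pred // subrr.
by rewrite mulf_eq0 subr_eq0 (negPf xm) => /eqP.
Qed.

Lemma cube_eq x y w : w ^+ 2 + w + 1 = 0 ->
  (x ^+ 3 == y ^+ 3) = [|| x == y, x == w * y | x == w ^+ 2 * y].
Proof.
move=> w2; have ew : w ^+ 2 = - w - 1 by apply/eqP; rewrite -subr_eq0; apply/eqP; rewrite -w2; ring.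
rewrite -[x ^+ 3 == _]subr_eq0 -[x == y]subr_eq0 -[x == w * y]subr_eq0.
rewrite -[x == w ^+ 2 * y]subr_eq0 -!mulf_eq0; congr (_ == 0).
ring: ew.
Qed.

End FiniteFieldCubes.

(** * Classes up to scaling, and the count for [q] congruent to 0 or 2 modulo 3 *)

Section TwistClasses.
Variable F : finFieldType.
Implicit Types u v : F.

Lemma wisoP (E E' : wcoef F) :
  reflect (exists al be ga de, wchange E E' al be ga de) (wiso E E').
Proof.
apply: (iffP existsP) => -[al]; last first.
  by case=> be [ga [de chg]]; exists al; do 3![apply/existsP; eexists]; exact: chg.
by move=> /existsP[be /existsP[ga /existsP[de chg]]]; exists al, be, ga, de.
Qed.

Lemma wiso_sym (E E' : wcoef F) : wiso E E' -> wiso E' E.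
Proof.
case/wisoP=> al [be [ga [de chg]]]; apply/wisoP.
by do 4!eexists; exact: wchange_inv chg.
Qed.

Lemma GH_twist_wiso u v u' v' : GH_twist u v u' v' -> wiso (GH_W u v) (GH_W u' v').
Proof.
case=> c [c0 eu ev]; apply/wisoP; exists c, 0, 0, 0.
exact: wchange_GH_scale.
Qed.

Lemma GH_twist_ratio u v u' v' : u != 0 -> u' != 0 ->
  v / u ^+ 3 = v' / u' ^+ 3 -> GH_twist u v u' v'.
Proof.
move=> u0 u'0 e; exists (u / u'); split; first by rewrite mulf_neq0 ?invr_eq0.
  by rewrite divfK.
have -> : v = (v / u ^+ 3) * u ^+ 3 by field.
by rewrite e; field.
Qed.

Lemma GH_twist_ratioE u v u' v' : GH_twist u v u' v' ->
  v / u ^+ 3 = v' / u' ^+ 3 /\ (u == 0) = (u' == 0).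
Proof.
case=> c [c0 -> ->]; split; last by rewrite mulf_eq0 (negPf c0).
by rewrite exprMn -mulf_div divff ?mul1r // expf_neq0.
Qed.

(** Division by zero yields 0, so curves with [u = 0] contribute the value 0. In characteristic 3
    smoothness forces [u != 0], and the excluded value [27^-1] is then 0 itself, so one value is
    missing in every characteristic. *)
Lemma GH_ratio_image :
  [set p.2 / p.1 ^+ 3 | p in GH_params F] = [set~ 27%:R^-1].
Proof.
apply/setP=> t; rewrite !inE; apply/imsetP/idP => [[[u v]]|t27].
  rewrite inE /= => /andP[v0 ns] ->; apply: contraNneq ns => e.
  have [u0|u0] := eqVneq u 0.
    have : (27%:R : F)^-1 == 0 by rewrite -e u0 expr0n invr0 mulr0.
    by rewrite invr_eq0 => /eqP->; rewrite u0 expr0n mul0r.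
  have n27 : (27%:R : F) != 0.
    by rewrite -invr_eq0 -e mulf_neq0 // invr_eq0 expf_neq0.
  apply/eqP; have -> : v = (v / u ^+ 3) * u ^+ 3 by field.
  by rewrite e; field.
have [t0|t0] := eqVneq t 0.
  exists (0, 1); last by rewrite /= expr0n invr0 mulr0.
  rewrite inE /= oner_eq0 expr0n mulr1 eq_sym /=.
  by apply: contraNneq t27 => ->; rewrite invr0 t0.
exists (1, t); last by rewrite /= expr1n divr1.
rewrite inE /= t0 expr1n; apply: contraNneq t27 => e.
have n27 : (27%:R : F) != 0 by apply: contra_eq_neq e => ->; rewrite mul0r oner_eq0.
by apply/eqP/(mulfI n27); rewrite -e divff.
Qed.

(** When isomorphisms are scalings, the ratio [v / u^3] is a complete invariant. For [u = 0] this
    relies on cubing being bijective: [v / v'] is then a cube, so such curves form at most one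
    class. *)
Lemma I_GH_twist : injective (fun x : F => x ^+ 3) ->
  {in GH_params F &, forall p p', GH_iso p p' -> GH_twist p.1 p.2 p'.1 p'.2} ->
  I_GH F = (#|F| - 1)%N.
Proof.
move=> cube_inj iso_twist; rewrite subn1 -(cardsC1 (27%:R^-1 : F)) -GH_ratio_image.
apply: card_classes => -[u v] [u' v'] pD p'D; apply/idP/eqP => [|/= e].
  by case/(iso_twist _ _ pD p'D)/GH_twist_ratioE.
apply: GH_twist_wiso => /=; move: pD p'D; rewrite !inE /= => /andP[v0 _] /andP[v'0 _].
have [u0|u0] := eqVneq u 0.
  have u'0 : u' = 0.
    apply/eqP; move/eqP: e; rewrite u0 expr0n invr0 mulr0 eq_sym mulf_eq0 (negPf v'0).
    by rewrite invr_eq0 expf_eq0.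
  have [g _ gK] := injF_bij cube_inj.
  exists (g (v / v')); split; rewrite ?u0 ?u'0 ?mulr0 ?gK //; last by rewrite divfK.
  by rewrite -[_ == 0](expf_eq0 _ 3) gK mulf_neq0 ?invr_eq0.
apply: GH_twist_ratio => //; apply: contraNneq u0 => u'0.
by move/eqP: e; rewrite u'0 expr0n invr0 mulr0 mulf_eq0 (negPf v0) invr_eq0 expf_eq0.
Qed.

(** In characteristic 3 the j-invariant collapses to [u^3 / v], which determines the ratio. The
    classification of changes of variables, valid only for [3 != 0], is bypassed. *)
Lemma I_GH_mod0 : (#|F| %% 3 = 0)%N -> I_GH F = (#|F| - 1)%N.
Proof.
move/eqP; rewrite card_mod3_eq0 => /eqP F3.
have F27 : (27%:R : F) = 0 by rewrite (_ : 27 = 3 ^ 3)%N // natrX F3 expr0n.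
have F216 : (216%:R : F) = 0 by rewrite (_ : 216 = 27 * 8)%N // natrM F27 mul0r.
apply: I_GH_twist => [x y /= e|[u v] [u' v']].
  apply/eqP; rewrite -subr_eq0 -[_ == 0](expf_eq0 _ 3).
  have -> : (x - y) ^+ 3 = x ^+ 3 - y ^+ 3 - 3%:R * x * y * (x - y) by ring.
  by rewrite e F3 subrr !mul0r subr0.
rewrite !inE /= F27 !mul0r !expf_eq0 /= => /andP[v0 u0] /andP[v'0 u'0].
case/wisoP=> al [be [ga [de /wchange_GH_j]]] /=.
rewrite /GH_j F27 F216 !mul0r !addr0 !subr0 => e.
have jE (a b : F) : a != 0 -> b != 0 ->
    a ^+ 3 * (a ^+ 3) ^+ 3 / (b * (a ^+ 3) ^+ 3) = (b / a ^+ 3)^-1.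
  by move=> a0 b0; field; rewrite b0 a0.
by apply: GH_twist_ratio => //; apply: invr_inj; rewrite -!jE.
Qed.

Lemma I_GH_mod2 : (#|F| %% 3 = 2)%N -> I_GH F = (#|F| - 1)%N.
Proof.
move=> q2; have no_w := no_omega q2.
have F3 : 3%:R != 0 :> F by rewrite -card_mod3_eq0 q2.
apply: I_GH_twist => [x y /= e|[u v] [u' v'] _ _]; last first.
  case/wisoP=> al [be [ga [de chg]]].
  exact: wchange_GH_twist_irrational chg.
apply/eqP; rewrite -subr_eq0; have [y0|y0] := eqVneq y 0.
  by rewrite y0 subr0 -[_ == 0](expf_eq0 _ 3) e y0 expr0n.
have /eqP : (x - y) * ((x / y) ^+ 2 + x / y + 1) = 0.
  transitivity ((x ^+ 3 - y ^+ 3) / y ^+ 2); first by field.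
  by rewrite e subrr mul0r.
by rewrite mulf_eq0 (negPf (no_w _)) orbF.
Qed.

End TwistClasses.

(** * The j-invariant on the Hessian pencil and its twelvefold symmetry *)

Section HessianInvariant.
Variable F : fieldType.
Implicit Types x y : F.

(* 27 * hess_j x is the j-invariant of X^3 + Y^3 + 1 = 3 x X Y. *)
Definition hess_j x := x ^+ 3 * (x ^+ 3 + 8%:R) ^+ 3 / (x ^+ 3 - 1) ^+ 3.

Lemma GH_j_hess x b : 3%:R != 0 :> F -> b != 0 -> x ^+ 3 != 1 ->
  GH_j (3%:R * x * b) (b ^+ 3) = 27%:R * hess_j x.
Proof.
move=> F3 b0 x1; have F27 : 27%:R != 0 :> F by rewrite (_ : 27 = 3 ^ 3)%N // natrX expf_neq0.
rewrite -subr_eq0 in x1; rewrite /GH_j /hess_j; field.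
rewrite x1 b0 /= (_ : _ - _ = 27%:R * b ^+ 3 * (x ^+ 3 - 1)); last by ring.
by rewrite !mulf_neq0 // expf_neq0.
Qed.

Variable w : F.
Hypothesis w2 : w ^+ 2 + w + 1 = 0.
Hypothesis F3 : 3%:R != 0 :> F.

Let ew : w ^+ 2 = - w - 1.
Proof. by apply/eqP; rewrite -subr_eq0 -w2; apply/eqP; ring. Qed.

Let w3 : w ^+ 3 = 1.
Proof. ring: ew. Qed.

Let w_neq0 : w != 0.
Proof. by apply: contra_eq_neq w3 => ->; rewrite expr0n eq_sym oner_eq0. Qed.

Let w_neq1 : w != 1.
Proof. by apply: contraNneq F3 => w1; rewrite -w2 w1; apply/eqP; ring. Qed.

(** Up to a cube root of unity, [x] is [(y + 2) / (y - 1)]. Denominators are cleared so that the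
    factorisation in [hess_j_eq] is a polynomial identity. *)
Definition hess_conj x y := (x * (y - 1)) ^+ 3 == (y + 2%:R) ^+ 3.

Lemma hess_j_eq x x' : x ^+ 3 != 1 -> x' ^+ 3 != 1 ->
  (hess_j x == hess_j x') = [|| x' ^+ 3 == x ^+ 3, hess_conj x' x,
                                hess_conj x' (w * x) | hess_conj x' (w ^+ 2 * x)].
Proof.
rewrite -!(subr_eq0 _ 1) => x1 x'1.
rewrite /hess_j eqr_div ?expf_neq0 // /hess_conj.
rewrite -[LHS]subr_eq0 -[x' ^+ 3 == _]subr_eq0.
rewrite -[(_ * (x - 1)) ^+ 3 == _]subr_eq0 -[(_ * (w * x - 1)) ^+ 3 == _]subr_eq0.
rewrite -[(_ * (w ^+ 2 * x - 1)) ^+ 3 == _]subr_eq0 -!mulf_eq0 -oppr_eq0; congr (_ == 0).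
rewrite !(exprMn _ x'); move: (x' ^+ 3) => s.
ring: ew.
Qed.

(* The excluded values are the degenerate members of the pencil and the zeros of
   j and of j - 1728. *)
Definition hess_generic x :=
  [&& x ^+ 3 != 1, x != 0, x ^+ 3 != - 8%:R & x ^+ 6 - 20%:R * x ^+ 3 - 8%:R != 0].

Lemma hess_j_neq0 x : x ^+ 3 != 1 ->
  (hess_j x == 0) = (x == 0) || (x ^+ 3 == - 8%:R).
Proof.
rewrite -subr_eq0 => x1.
by rewrite /hess_j mulf_eq0 invr_eq0 mulf_eq0 !expf_eq0 (negPf x1) orbF /= addr_eq0.
Qed.

(** The value 64 corresponds to [j = 27 * 64 = 1728]. The numerator of the difference is a perfect
    square, reflecting double ramification there. *)
Lemma hess_j_eq64 x : x ^+ 3 != 1 ->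
  (hess_j x == 64%:R) = (x ^+ 6 - 20%:R * x ^+ 3 - 8%:R == 0).
Proof.
rewrite -subr_eq0 => x1; rewrite -[LHS]subr_eq0.
have -> : hess_j x - 64%:R = (x ^+ 6 - 20%:R * x ^+ 3 - 8%:R) ^+ 2 / (x ^+ 3 - 1) ^+ 3.
  by rewrite /hess_j; field.
by rewrite mulf_eq0 invr_eq0 !expf_eq0 (negPf x1) orbF.
Qed.

Lemma hess_generic_omega x : hess_generic (w * x) = hess_generic x.
Proof.
have e6 : (w * x) ^+ 6 = x ^+ 6 by rewrite exprMn (exprM w 3 2) w3 expr1n mul1r.
by rewrite /hess_generic e6 exprMn w3 mul1r mulf_eq0 (negPf w_neq0).
Qed.

(** The conditions are split over [w] because differences between conjugates of [x] are products of
    these factors. *)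
Lemma hess_generic_factors x : hess_generic x ->
  [/\ x != 0, x - 1 != 0, x - w != 0, x - w ^+ 2 != 0 &
   [/\ x + 2%:R != 0, x + 2%:R * w != 0, x + 2%:R * w ^+ 2 != 0,
       x ^+ 2 - 2%:R * x - 2%:R != 0 &
       x ^+ 2 - 2%:R * w * x - 2%:R * w ^+ 2 != 0]].
Proof.
case/and4P; rewrite -subr_eq0 -[x ^+ 3 == - _]subr_eq0.
have -> : x ^+ 3 - 1 = (x - 1) * (x - w) * (x - w ^+ 2) by ring: ew.
have -> : x ^+ 3 - - 8%:R = (x + 2%:R) * (x + 2%:R * w) * (x + 2%:R * w ^+ 2) by ring: ew.
have -> : x ^+ 6 - 20%:R * x ^+ 3 - 8%:R = (x ^+ 2 - 2%:R * x - 2%:R)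
    * (x ^+ 2 - 2%:R * w * x - 2%:R * w ^+ 2) * (x ^+ 2 - 2%:R * w ^+ 2 * x - 2%:R * w) by ring: ew.
rewrite !mulf_eq0 !negb_or => /andP[/andP[-> ->] ->] ->.
by move=> /andP[/andP[-> ->] ->] /andP[/andP[-> ->] _].
Qed.

Definition hess_map x := (x + 2%:R) / (x - 1).

Lemma hess_conjE x y : y != 1 -> hess_conj x y = (x ^+ 3 == hess_map y ^+ 3).
Proof.
rewrite -subr_eq0 => y1; rewrite /hess_conj /hess_map expr_div_n exprMn.
by rewrite -[RHS](inj_eq (mulIf (expf_neq0 3 y1))) divfK // expf_neq0.
Qed.

(** Two conjugates can coincide only at a singular member or over [j = 0] or [j = 1728]: the
    difference factors into polynomials that genericity keeps nonzero. *)
Lemma hess_map_cube_neq_id x : hess_generic x -> hess_map x ^+ 3 != x ^+ 3.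
Proof.
case/hess_generic_factors=> x0 x1 xw xww [_ y1 y2 z _].
have nx1 : x != 1 by rewrite -subr_eq0.
rewrite eq_sym -(hess_conjE x nx1) /hess_conj -[_ == _]subr_eq0.
have -> : (x * (x - 1)) ^+ 3 - (x + 2%:R) ^+ 3 = (x ^+ 2 - 2%:R * x - 2%:R)
   * ((x + 2%:R * w) * (x - w)) * ((x + 2%:R * w ^+ 2) * (x - w ^+ 2)) by ring: ew.
by rewrite !mulf_neq0.
Qed.

Lemma hess_map_cube_neq_omega x : hess_generic x -> hess_map x ^+ 3 != hess_map (w * x) ^+ 3.
Proof.
move=> gx; have gwx := gx; rewrite -hess_generic_omega in gwx.
have [x0 x1 xw xww [_ y1 y2 z zw]] := hess_generic_factors gx.
have [_ wx1 _ _ _] := hess_generic_factors gwx.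
rewrite /hess_map !expr_div_n eqr_div ?expf_neq0 // -subr_eq0.
have -> : (x + 2%:R) ^+ 3 * (w * x - 1) ^+ 3 - (w * x + 2%:R) ^+ 3 * (x - 1) ^+ 3
    = 3%:R * (w - 1) * x * (w * (1 - w) * ((x + 2%:R * w) * (x - w)))
      * ((w - 1) * (x ^+ 2 - 2%:R * w * x - 2%:R * w ^+ 2)) by ring: ew.
have w1 : w - 1 != 0 by rewrite subr_eq0.
by rewrite !mulf_neq0 // -opprB oppr_eq0.
Qed.

End HessianInvariant.

(** * The number of j-invariants of smooth Hessian curves *)

Section CubeCount.
Variable F : finFieldType.
Implicit Types x y : F.
Variable w : F.
Hypothesis w2 : w ^+ 2 + w + 1 = 0.
Hypothesis F3 : 3%:R != 0 :> F.

Let ew : w ^+ 2 = - w - 1.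
Proof. by apply/eqP; rewrite -subr_eq0 -w2; apply/eqP; ring. Qed.

Let w3 : w ^+ 3 = 1.
Proof. ring: ew. Qed.

Let w_neq1 : w != 1.
Proof. by apply: contraNneq F3 => w1; rewrite -w2 w1; apply/eqP; ring. Qed.

Let w_neq0 : w != 0.
Proof. by apply: contra_eq_neq w3 => ->; rewrite expr0n eq_sym oner_eq0. Qed.

Lemma card_cube_fibre x : x != 0 -> #|[set y | y ^+ 3 == x ^+ 3]| = 3%N.
Proof.
move=> x0; have -> : [set y | y ^+ 3 == x ^+ 3] = x |: [set w * x; w ^+ 2 * x].
  by apply/setP=> y; rewrite !inE (cube_eq _ _ w2).
have wx z z' : (z * x == z' * x) = (z == z') by rewrite (inj_eq (mulIf x0)).
have wE : (w == w ^+ 2) = false.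
  apply: contraNF w_neq1 => /eqP e.
  by rewrite -(inj_eq (mulfI w_neq0)) mulr1 -expr2 -e.
have w1E : (1 == w ^+ 2) = false.
  by rewrite -(inj_eq (mulfI w_neq0)) -exprS w3 mulr1; exact: negPf.
rewrite cardsU1 cards2 !inE -[x in x == _]mul1r -[x in x == w ^+ 2 * _]mul1r.
by rewrite !wx eq_sym (negPf w_neq1) w1E wE.
Qed.

Lemma card_cube_closed (D : {set F}) :
  {in D, forall x, x != 0} -> (forall x y, x \in D -> y ^+ 3 = x ^+ 3 -> y \in D) ->
  #|D| = (#|[set x ^+ 3 | x in D]| * 3)%N.
Proof.
move=> D0 Dcube; apply: card_uniform_fibres => x xD.
apply: etrans (card_cube_fibre (D0 x xD)); apply: eq_card => y; rewrite !inE.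
by case: eqP => [e|_]; rewrite ?andbF // (Dcube _ _ xD e).
Qed.

Definition hess_smooth := [set x : F | x ^+ 3 != 1].

Lemma card_hess_smooth : #|hess_smooth| = (#|F| - 3)%N.
Proof.
have := cardsC [set y : F | y ^+ 3 == 1 ^+ 3]; rewrite card_cube_fibre ?oner_eq0 //.
move=> <-; rewrite addKn; apply: eq_card => x.
by rewrite !inE expr1n.
Qed.

(** The cubes of the points of the fibre take four distinct nonzero values, and each value has three
    cube roots. *)
Lemma card_hess_j_fibre x : hess_generic x ->
  #|[set y in hess_smooth | hess_j y == hess_j x]| = 12%N.
Proof.
move=> gx; have gwx := gx; rewrite -(hess_generic_omega w2) in gwx.
have gwwx := gwx; rewrite -(hess_generic_omega w2) mulrA -expr2 in gwwx.
have neq1 y : hess_generic y -> y != 1.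
  by case/and4P=> y1 _ _ _; apply: contraNneq y1 => ->; rewrite expr1n.
have smooth y : hess_generic y -> y ^+ 3 != 1 by case/and4P.
have cube_omega y : (w * y) ^+ 3 = y ^+ 3 by rewrite exprMn w3 mul1r.
(* Conjugates stay smooth, so the fibre is not cut down by [hess_smooth], and nonzero, so that each
   has three cube roots. *)
have cube_map y : hess_generic y -> (hess_map y ^+ 3 != 1) && (hess_map y != 0).
  move=> gy; have [y0 y1 yw yww [y2 y3 y4 _ _]] := hess_generic_factors w2 gy.
  rewrite /hess_map expr_div_n -subr_eq0 mulf_neq0 ?invr_eq0 // andbT.
  have -> : (y + 2%:R) ^+ 3 / (y - 1) ^+ 3 - 1
      = 9%:R * (y - w) * (y - w ^+ 2) / (y - 1) ^+ 3.
    have -> : 9%:R * (y - w) * (y - w ^+ 2) = (y + 2%:R) ^+ 3 - (y - 1) ^+ 3 by ring: ew.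
    by field.
  rewrite !mulf_neq0 ?invr_eq0 ?expf_neq0 //.
  by rewrite (_ : 9 = 3 * 3)%N // natrM mulf_neq0.
pose D := [set y in hess_smooth | hess_j y == hess_j x].
have DE y : (y \in D) = (y ^+ 3 \in [set x ^+ 3; hess_map x ^+ 3;
     hess_map (w * x) ^+ 3; hess_map (w ^+ 2 * x) ^+ 3]).
  rewrite !inE -!orbA -(hess_conjE _ (neq1 _ gx)).
  rewrite -(hess_conjE _ (neq1 _ gwx)) -(hess_conjE _ (neq1 _ gwwx)).
  case y1: (y ^+ 3 == 1); last first.
    by rewrite eq_sym (hess_j_eq w2) ?y1 ?smooth.
  rewrite !hess_conjE ?(neq1 _ gx) ?(neq1 _ gwx) ?(neq1 _ gwwx) //.
  rewrite (eqP y1) ![1 == _]eq_sym (negPf (smooth _ gx)).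
  have [] := And3 (cube_map _ gx) (cube_map _ gwx) (cube_map _ gwwx).
  by move=> /andP[/negPf-> _] /andP[/negPf-> _] /andP[/negPf-> _].
rewrite card_cube_closed -/D; first last.
- by move=> y z yD e; rewrite DE e -DE.
- move=> y; rewrite DE !inE -[y == 0](expf_eq0 _ 3).
  have x0 : x ^+ 3 != 0 by case/and4P: gx => _ x0 _ _; rewrite expf_neq0.
  have [m0 m1 m2] := And3 (cube_map _ gx) (cube_map _ gwx) (cube_map _ gwwx).
  rewrite -!orbA => /or4P[]/eqP-> //; apply: expf_neq0.
  - by case/andP: m0.
  - by case/andP: m1.
  - by case/andP: m2.
have -> : [set y ^+ 3 | y in D] = [set x ^+ 3; hess_map x ^+ 3;
     hess_map (w * x) ^+ 3; hess_map (w ^+ 2 * x) ^+ 3].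
  apply/setP=> c; apply/imsetP/idP => [[y yD ->]|]; first by rewrite -DE.
  move=> cT; suff [y cE] : exists y, c = y ^+ 3 by exists y; rewrite ?DE -?cE.
  by move: cT; rewrite !inE -!orbA => /or4P[]/eqP->; eexists.
rewrite -setUA setUC -setUA. 
rewrite !cardsU1 !inE cards1.
(* [n1] to [n3] separate [x^3] from the other three values; [n4] to [n6] separate these from one
   another. *)
have n1 := hess_map_cube_neq_id w2 gx.
have n2 := hess_map_cube_neq_id w2 gwx; rewrite cube_omega in n2.
have n3 := hess_map_cube_neq_id w2 gwwx; rewrite expr2 -mulrA !cube_omega in n3.
have n4 := hess_map_cube_neq_omega w2 F3 gx.
have n5 := hess_map_cube_neq_omega w2 F3 gwx.
have n6 := hess_map_cube_neq_omega w2 F3 gwwx.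
have e1 : w * (w * x) = w ^+ 2 * x by ring.
have e2 : w * (w ^+ 2 * x) = x by rewrite mulrA -exprS w3 mul1r.
rewrite e1 in n5; rewrite e2 in n6.
rewrite e1 in n3.
rewrite eq_sym in n4; rewrite eq_sym in n1.
by rewrite (negPf n5) (negPf n2) (negPf n4) (negPf n3) (negPf n6) n1.
Qed.

Lemma hess_genericE x : x \in hess_smooth ->
  hess_generic x = (hess_j x != 0) && (hess_j x != 64%:R).
Proof.
rewrite inE => x1.
by rewrite /hess_generic x1 hess_j_neq0 // hess_j_eq64 // negb_or -andbA.
Qed.

Let S0 := [set x in hess_smooth | hess_j x == 0].
(** The condition [hess_j x != 0] makes this set empty in characteristic 2, where [64 = 0] and the
    two special fibres coincide. *)
Let S1 := [set x in hess_smooth | (hess_j x == 64%:R) && (hess_j x != 0)].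

Lemma card_hess_generic :
  #|[set x | hess_generic (x : F)]|
    = (#|[set hess_j x | x in [set x | hess_generic (x : F)]]| * 12)%N.
Proof.
apply: card_uniform_fibres => x; rewrite inE => gx.
apply: etrans (card_hess_j_fibre gx); apply: eq_card => y; rewrite [LHS]inE [RHS]inE.
case e: (hess_j y == hess_j x); rewrite ?andbF ?andbT // inE.
have xS : x \in hess_smooth by rewrite inE; case/and4P: gx.
case yS: (y \in hess_smooth); last first.
  by apply: contraFF yS; rewrite inE => /and4P[].
by rewrite hess_genericE // (eqP e) -hess_genericE.
Qed.

Lemma mem_hess_j0 x : (x \in S0) = (x == 0) || (x ^+ 3 == - 8%:R).
Proof.
rewrite !inE; case x1: (x ^+ 3 == 1); last by rewrite hess_j_neq0 ?x1.
apply/esym/negbTE; rewrite negb_or.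
rewrite -[x == 0](expf_eq0 _ 3) (eqP x1) oner_eq0 /= -subr_eq0.
by rewrite (_ : _ - _ = 3%:R * 3%:R) ?mulf_neq0 //; ring.
Qed.

Lemma card_hess_j0 : #|S0| = if (2%:R : F) == 0 then 1%N else 4%N.
Proof.
have eN8 : - 8%:R = (- 2%:R) ^+ 3 :> F by ring.
have -> : S0 = 0 |: [set x | x ^+ 3 == (- 2%:R) ^+ 3].
  by apply/setP=> x; rewrite mem_hess_j0 !inE eN8.
case: eqP => [two0|/eqP two0].
  have -> : [set x : F | x ^+ 3 == (- 2%:R) ^+ 3] = [set 0].
    by apply/setP=> x; rewrite !inE two0 oppr0 (expr0n _ 3) /= expf_eq0.
  by rewrite setUid cards1.
have two0' : - 2%:R != 0 :> F by rewrite oppr_eq0.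
rewrite cardsU1 card_cube_fibre // inE (expr0n _ 3) eq_sym.
by rewrite expf_eq0 (negPf two0').
Qed.

(** The cubes [t = x^3] satisfy [t^2 - 20 t - 8 = 0]. If there is a solution, some [y] among [x],
    [w x], [w^2 x] satisfies [y^2 = 2 y + 2]. The conjugate root [2 - y] has cube [20 - t], the
    other root of the quadratic in [t], which gives two cubes and six points. *)
Lemma card_hess_j1728 : #|S1| = if S1 == set0 then 0%N else 6%N.
Proof.
case: eqP => [->|/eqP/set0Pn[x xS1]]; first by rewrite cards0.
have n64 : 64%:R != 0 :> F by move: xS1; rewrite !inE => /and3P[_ /eqP->].
have n2 : 2%:R != 0 :> F.
  by apply: contraNneq n64 => e; rewrite (_ : 64 = 2 * 32)%N // natrM e mul0r.
have n8 : 8%:R != 0 :> F by rewrite (_ : 8 = 2 ^ 3)%N // natrX expf_neq0.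
have S1E y : (y \in S1) = (y ^+ 6 - 20%:R * y ^+ 3 - 8%:R == 0).
  rewrite !inE; case y1: (y ^+ 3 == 1).
    apply/esym/negbTE; rewrite (exprM y 3 2) (eqP y1) expr1n mulr1.
    rewrite (_ : _ - _ = - (3%:R * 3%:R * 3%:R)); last by ring.
    by rewrite oppr_eq0 !mulf_eq0 !(negPf F3).
  rewrite /= -hess_j_eq64 ?y1 //.
  by case: eqP => [->|].
have [y yx ey] : exists2 y, y ^+ 3 = x ^+ 3 & y ^+ 2 = 2%:R * y + 2%:R.
  have sol y : y ^+ 2 - 2%:R * y - 2%:R == 0 -> y ^+ 2 = 2%:R * y + 2%:R.
    by move/eqP=> e; apply/eqP; rewrite -subr_eq0 -e; apply/eqP; ring.
  move: xS1; rewrite S1E.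
  have -> : x ^+ 6 - 20%:R * x ^+ 3 - 8%:R = (x ^+ 2 - 2%:R * x - 2%:R)
     * ((w * x) ^+ 2 - 2%:R * (w * x) - 2%:R)
     * ((w ^+ 2 * x) ^+ 2 - 2%:R * (w ^+ 2 * x) - 2%:R) by ring: ew.
  rewrite !mulf_eq0 -orbA => /or3P[]/sol e; [exists x | exists (w * x) | exists (w ^+ 2 * x)] => //.
    by rewrite exprMn w3 mul1r.
  by rewrite exprMn exprAC w3 expr1n mul1r.
have et : (x ^+ 3) ^+ 2 - 20%:R * x ^+ 3 - 8%:R = 0.
  by move: xS1; rewrite S1E (exprM x 3 2) => /eqP.
have ez : (2%:R - y) ^+ 3 = 20%:R - x ^+ 3 by rewrite -yx; ring: ey.
rewrite card_cube_closed.
- have -> : [set c ^+ 3 | c in S1] = [set x ^+ 3; 20%:R - x ^+ 3].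
    apply/setP=> c; rewrite !inE; apply/imsetP/idP => [[z]|].
      rewrite S1E (exprM z 3 2) => /eqP ec ->.
      rewrite -subr_eq0 -[z ^+ 3 == _ - _]subr_eq0 -mulf_eq0.
      have -> : (z ^+ 3 - x ^+ 3) * (z ^+ 3 - (20%:R - x ^+ 3)) =
        ((z ^+ 3) ^+ 2 - 20%:R * z ^+ 3 - 8%:R) - ((x ^+ 3) ^+ 2 - 20%:R * x ^+ 3 - 8%:R) by ring.
      by rewrite ec et subrr.
    case/orP=> /eqP->; first by exists x.
    exists (2%:R - y) => //; rewrite S1E (exprM _ 3 2) ez -et; apply/eqP; ring.
  rewrite cards2; suff -> : x ^+ 3 != 20%:R - x ^+ 3 by [].
  apply: contraTneq isT => e; have e20 : 2%:R * x ^+ 3 = 20%:R.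
    by transitivity (x ^+ 3 + (20%:R - x ^+ 3)); [rewrite -e; ring | ring].
  (* [2^4 * 3^3 = 432] is the discriminant of [t^2 - 20 t - 8], so a double root is impossible
     here. *)
  have /eqP : 2%:R ^+ 4 * 3%:R ^+ 3 = 0 :> F.
    have -> : 2%:R ^+ 4 * 3%:R ^+ 3 = - 4%:R * ((x ^+ 3) ^+ 2 - 20%:R * x ^+ 3 - 8%:R)
       + (2%:R * x ^+ 3) ^+ 2 - 40%:R * (2%:R * x ^+ 3) + 400%:R :> F by ring.
    by rewrite et e20; ring.
  by rewrite mulf_eq0 !expf_eq0 (negPf n2) (negPf F3).
- move=> z; rewrite S1E; apply: contraTneq => ->.
  by rewrite !expr0n mulr0 subr0 add0r oppr_eq0.
- by move=> z z'; rewrite !S1E !(exprM _ 3 2) => ez' ->.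
Qed.

(** With [k] the number of generic values, [q - 3] is [12 k] plus the sizes of the fibres over 0 and
    1728. The alternatives are characteristic 2, another characteristic with no point over 1728, and
    another characteristic with six such points. *)
Lemma card_hess_j_image (A := [set hess_j x | x in hess_smooth]) : exists k,
  [\/ #|F| = 12 * k + 4 /\ #|A| = k + 1, #|F| = 12 * k + 7 /\ #|A| = k + 1
    | #|F| = 12 * k + 13 /\ #|A| = k + 2]%N.
Proof.
rewrite {}/A; set G := [set x : F | hess_generic x].
exists #|@hess_j F @: G|.
pose S' := [set x in hess_smooth | hess_j x != 0].
have S0I : S0 = [set x in hess_smooth | hess_j x \in [set 0]].
  by apply/setP=> x; rewrite !inE.
have S'I : S' = [set x in hess_smooth | hess_j x \notin [set 0]].
  by apply/setP=> x; rewrite !inE.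
have S1I : S1 = [set x in S' | hess_j x \in [set 64%:R]].
  by apply/setP=> x; rewrite !inE -andbA; congr andb; rewrite andbC.
have GI : G = [set x in S' | hess_j x \notin [set 64%:R]].
  apply/setP=> x; rewrite [LHS]in_set [RHS]in_set [x \in S']in_set in_set1 -andbA.
  case xS: (x \in hess_smooth); first exact: hess_genericE.
  by apply: contraFF xS; rewrite inE => /and4P[].
have splitA : #|@hess_j F @: hess_smooth|
    = (#|@hess_j F @: S0| + (#|@hess_j F @: S1| + #|@hess_j F @: G|))%N.
  by rewrite S1I GI -card_imset_preimID S0I S'I -card_imset_preimID.
have splitS : #|hess_smooth| = (#|S0| + (#|S1| + #|G|))%N.
  have cardID (D : {set F}) (P : pred F) :
      #|D| = (#|[set x in D | P x]| + #|[set x in D | ~~ P x]|)%N.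
    rewrite -(cardsID [set x | P x] D); congr (_ + _)%N; apply: eq_card => x.
      by rewrite !inE.
    by rewrite !inE andbC.
  by rewrite S1I GI -cardID // S0I S'I -cardID.
have im0 : #|@hess_j F @: S0| = 1%N.
  rewrite (_ : _ @: S0 = [set 0]) ?cards1 //; apply/setP=> y; rewrite inE.
  apply/imsetP/eqP => [[x]|->]; first by rewrite inE => /andP[_ /eqP->].
  have x0 : 0 ^+ 3 != 1 :> F by rewrite (expr0n _ 3) eq_sym oner_eq0.
  have j0 : hess_j (0 : F) = 0 by apply/eqP; rewrite hess_j_neq0 ?eqxx.
  by exists 0; rewrite // !inE x0 j0 eqxx.
have im1 : #|@hess_j F @: S1| = (S1 != set0).
  case: eqP => [->|/eqP/set0Pn[x xS]]; first by rewrite imset0 cards0.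
  rewrite (_ : _ @: S1 = [set 64%:R]) ?cards1 //; apply/setP=> y; rewrite inE.
  apply/imsetP/eqP => [[z]|->]; first by rewrite !inE => /and3P[_ /eqP->].
  by exists x => //; move: xS; rewrite !inE => /and3P[_ /eqP->].
have h01 : (2%:R : F) == 0 -> S1 == set0.
  move/eqP=> n2; apply/eqP/setP=> x; rewrite !inE.
  have -> : 64%:R = 0 :> F by rewrite (_ : 64 = 2 * 32)%N // natrM n2 mul0r.
  by rewrite andbN andbF.
have := card_hess_smooth; rewrite splitS card_hess_generic card_hess_j0 card_hess_j1728.
rewrite splitA im0 im1 -/G; move: #|_ @: G| => k.
case n2: ((2%:R : F) == 0); first by rewrite (h01 n2) /= => e; apply: Or31; lia.
case: (S1 == set0) => /= e; first by apply: Or32; lia.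
by apply: Or33; lia.
Qed.

End CubeCount.

(** * The complete invariant and the count for [q] congruent to 1 modulo 3 *)

Section ThreeTorsion.
Variable F : finFieldType.
Implicit Types u v x : F.
Hypothesis q1 : (#|F| %% 3 = 1)%N.

Let F3 : 3%:R != 0 :> F.
Proof. by rewrite -card_mod3_eq0 q1. Qed.

Let m := (#|F| %/ 3)%N.

Let card3m : #|F| = (3 * m + 1)%N.
Proof. by rewrite /m; lia. Qed.

Let m_gt0 : (0 < m)%N.
Proof. by have : (1 < #|F|)%N := finNzRing_gt1 F; rewrite /m; lia. Qed.

Definition is_cube v := [exists b : F, v == b ^+ 3].

Lemma cube_is_cube x : is_cube (x ^+ 3).
Proof. by apply/existsP; exists x. Qed.

Lemma card_nonzero_cubes : #|[set x ^+ 3 | x in [set~ (0 : F)]]| = m.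
Proof.
have [w w2] := exists_omega q1.
have : #|[set~ (0 : F)]| = (#|[set (x ^+ 3)%R | x in [set~ (0 : F)%R]]| * 3)%N.
  apply: (card_cube_closed w2 F3) => [x|x y]; rewrite !inE // => x0 e.
  by rewrite -[y == 0](expf_eq0 _ 3) e expf_neq0.
by rewrite cardsC1 card3m addn1 /= => e; lia.
Qed.

(** Euler's criterion for cubes: the [m] nonzero cubes are roots of [X^m - 1], which has at most [m]
    roots. *)
Lemma expf_third_eq1 v : v != 0 -> (v ^+ m == 1) = is_cube v.
Proof.
move=> v0; pose C := [set x ^+ 3 | x in [set~ (0 : F)]].
have sub : C \subset [set x : F | x ^+ m == 1].
  apply/subsetP=> _ /imsetP[x + ->]; rewrite !inE => x0.
  by rewrite -exprM (_ : (3 * m)%N = #|F|.-1) ?expf_card_pred // card3m addn1.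
have eC : C = [set x : F | x ^+ m == 1].
  by apply/eqP; rewrite eqEcard sub card_nonzero_cubes card_expr_eq.
have -> : (v ^+ m == 1) = (v \in C) by rewrite eC inE.
apply/imsetP/existsP => [[x _ ->]|[b /eqP e]]; first by exists x.
by exists b; rewrite // !inE -[b == 0](expf_eq0 _ 3) -e.
Qed.

Lemma card_noncubes : #|[set v | ~~ is_cube v]| = (2 * m)%N.
Proof.
have -> : [set v | ~~ is_cube v] = ~: (0 |: [set x ^+ 3 | x in [set~ (0 : F)]]).
  apply/setP=> v; rewrite !inE; congr negb; apply/existsP/orP => [[b /eqP->]|[]].
  - have [->|b0] := eqVneq b 0; first by left; rewrite expr0n.
    by right; apply: imset_f; rewrite !inE.
  - by move/eqP->; exists 0; rewrite expr0n.
  - by case/imsetP=> x _ ->; exists x.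
have := cardsC (0 |: [set x ^+ 3 | x in [set~ (0 : F)]]).
rewrite cardsU1 card_nonzero_cubes card3m.
have -> : (0 \in [set x ^+ 3 | x in [set~ (0 : F)]]) = false.
  by apply/imsetP => -[x]; rewrite !inE => x0 /esym/eqP; rewrite expf_eq0 (negPf x0).
by move=> /= e; apply/eqP; rewrite -(eqn_add2l (1 + m)) e; apply/eqP; lia.
Qed.

(** On noncubes the cubic character [v^m] takes both primitive cube roots of unity as values; these
    label the two noncube classes with [u = 0]. *)
Lemma card_cubic_characters : #|[set v ^+ m | v in [set v | ~~ is_cube v]]| = 2%N.
Proof.
have nc0 v : ~~ is_cube v -> v != 0.
  by apply: contraNneq => ->; apply/existsP; exists 0; rewrite expr0n.
have w3 v : v != 0 -> (v ^+ m) ^+ 3 = 1.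
  by move=> v0; rewrite -exprM (_ : (m * 3)%N = #|F|.-1) ?expf_card_pred // card3m addn1 mulnC.
have /card_gt0P[v] : (0 < #|[set v | ~~ is_cube v]|)%N by rewrite card_noncubes; lia.
rewrite inE => ncv; have v0 := nc0 v ncv; pose w := v ^+ m.
have w1 : w != 1 by rewrite /w expf_third_eq1.
have w2 : w ^+ 2 + w + 1 = 0.
  have /eqP : (w - 1) * (w ^+ 2 + w + 1) = 0.
    by transitivity (w ^+ 3 - 1); [ring | rewrite w3 ?subrr].
  by rewrite mulf_eq0 subr_eq0 (negPf w1) => /eqP.
have w0 : w != 0 by rewrite expf_neq0.
have w21 : w ^+ 2 != 1.
  by apply: contra_neq w1 => e; rewrite -(w3 v v0) -/w exprS e mulr1.
have w2w : w != w ^+ 2.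
  by apply: contraNneq w1 => e; rewrite -(inj_eq (mulfI w0)) mulr1 -expr2 -e.
rewrite (_ : _ @: _ = [set w; w ^+ 2]) ?cards2 ?w2w //.
apply/setP=> z; rewrite !inE; apply/imsetP/orP => [[x]|[]/eqP->].
- rewrite inE => ncx ->; have := cube_eq (x ^+ m) 1 w2.
  rewrite w3 ?nc0 // expr1n eqxx expf_third_eq1 ?nc0 // (negPf ncx) !mulr1 /=.
  by move/esym/orP.
- by exists v; rewrite ?inE.
- exists (v ^+ 2); last by rewrite -!exprM mulnC.
  by rewrite inE -expf_third_eq1 ?expf_neq0 // -exprM mulnC exprM.
Qed.

Definition GH_smooth u v := (v != 0) && (u ^+ 3 != 27%:R * v).

(** Both curves are put in Hessian form. By [hess_j_eq] their parameters differ by a cube root of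
    unity, which is a scaling, or by the order 3 transformation combined with cube roots of unity,
    which [wchange_GH_hessian] realises. *)
Lemma GH_j_wiso u v u' v' : GH_smooth u v -> GH_smooth u' v' ->
  is_cube v -> is_cube v' -> GH_j u v = GH_j u' v' -> wiso (GH_W u v) (GH_W u' v').
Proof.
move=> /andP[v0 us] /andP[v'0 us'] /existsP[b /eqP eb] /existsP[b' /eqP eb'].
have [w w2] := exists_omega q1.
have b0 : b != 0 by rewrite -[b == 0](expf_eq0 _ 3) -eb.
have b'0 : b' != 0 by rewrite -[b' == 0](expf_eq0 _ 3) -eb'.
have F27 : 27%:R != 0 :> F by rewrite (_ : 27 = 3 ^ 3)%N // natrX expf_neq0.
have norm (s c : F) : c != 0 -> s ^+ 3 != 27%:R * c ^+ 3 ->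
    exists x, s = 3%:R * x * c /\ x ^+ 3 != 1.
  move=> c0 ns; exists (s / (3%:R * c)); split; first by field; rewrite c0 F3.
  apply: contraNneq ns => e; apply/eqP.
  transitivity (27%:R * c ^+ 3 * (s / (3%:R * c)) ^+ 3); last by rewrite e mulr1.
  by field; rewrite c0 F3.
rewrite {}eb in v0 us *; rewrite {}eb' in v'0 us' *.
have [x [-> x1]] := norm u b b0 us; have [x' [-> x'1]] := norm u' b' b'0 us'.
rewrite !GH_j_hess // => /(mulfI F27)/eqP; rewrite (hess_j_eq w2) //.
have w3 := omega_cube w2.
have ww3 : (w ^+ 2) ^+ 3 = 1 by rewrite -exprM mulnC exprM w3 expr1n.
have root1 (s t : F) : s ^+ 3 = t ^+ 3 -> exists2 z, z ^+ 3 = 1 & s = z * t.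
  move/eqP; rewrite (cube_eq _ _ w2) => /or3P[]/eqP->.
  - by exists 1; rewrite ?expr1n ?mul1r.
  - by exists w.
  - by exists (w ^+ 2).
have z0 (z : F) : z ^+ 3 = 1 -> z != 0.
  by move=> e; rewrite -[z == 0](expf_eq0 _ 3) e oner_eq0.
have [/eqP/root1[z z3 ->] _|_ /= conj] := boolP (x' ^+ 3 == x ^+ 3).
  have zn := z0 z z3; apply: GH_twist_wiso; exists (b / (z * b')); split.
  - by rewrite mulf_neq0 // invr_eq0 mulf_neq0.
  - by field; rewrite b'0 zn.
  - by rewrite expr_div_n exprMn z3 mul1r divfK.
have {conj} [z z3 /eqP/root1[z' z'3 e]] : exists2 z, z ^+ 3 = 1 & hess_conj x' (z * x).
  case/or3P: conj => cj; [exists 1 | exists w | exists (w ^+ 2)] => //.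
    by rewrite expr1n.
  by rewrite mul1r.
have zn := z0 z z3; apply/wisoP.
(* The roots of unity [z] and [z'] are absorbed by choosing other cube roots of [v] and [v']. *)
have -> : b ^+ 3 = (b / z) ^+ 3 by rewrite expr_div_n z3 divr1.
have -> : 3%:R * x * b = 3%:R * (z * x * (b / z)) by field.
have -> : b' ^+ 3 = (z' * b') ^+ 3 by rewrite exprMn z'3 mul1r.
apply: (wchange_GH_hessian F3 w2).
- by rewrite mulf_neq0 // (z0 _ z'3).
- have bz : b / z != 0 by rewrite mulf_neq0 // invr_eq0.
  rewrite -[X in _ != X]mul1r (inj_eq (mulIf bz)).
  by apply: contraNneq x1 => zx; rewrite -(expr1n _ 3) -zx exprMn z3 mul1r.
- transitivity (3%:R * b' * (b / z) * (x' * (z * x - 1))); first by field.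
  by rewrite e; field.
Qed.

(** The sum type keeps the three families apart so that their values are counted separately. For
    noncubes with [u = 0] the ratio carries no information, and the cubic character of [v] replaces
    it. *)
Definition GH_class u v : F + (F + F) :=
  if is_cube v then inl (GH_j u v)
  else inr (if u == 0 then inr (v ^+ m) else inl (v / u ^+ 3)).

Lemma GH_isoE : {in GH_params F &, forall p p',
  GH_iso p p' = (GH_class p.1 p.2 == GH_class p'.1 p'.2)}.
Proof.
have [w w2] := exists_omega q1.
have noncube_twist u v u' v' : ~~ is_cube v ->
    wiso (GH_W u v) (GH_W u' v') -> GH_twist u v u' v'.
  move=> ncv /wisoP[al [be [ga [de]]]]; apply: (wchange_GH_twist_noncube F3 w2) => b.
  by apply: contra ncv => vb; apply/existsP; exists b.
have twist_cube u v u' v' : GH_twist u v u' v' -> is_cube v' -> is_cube v.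
  by case=> c [_ _ ->] /existsP[b /eqP->]; rewrite -exprMn cube_is_cube.
move=> [u v] [u' v']; rewrite !inE /GH_iso /GH_class /= => sp sp'.
have [/andP[v0 _] /andP[v'0 _]] := (sp, sp').
case cv: (is_cube v); case cv': (is_cube v').
- apply/idP/eqP => [/wisoP[al [be [ga [de /wchange_GH_j->]]]]//|[]].
  exact: GH_j_wiso.
(* A scaling multiplies [v] by a cube, so a noncube is never matched with a cube; the noncube has to
   be the source, whence the symmetry. *)
- apply/negbTE/negP => /wiso_sym/noncube_twist; rewrite cv' => /(_ isT)/twist_cube.
  by rewrite cv cv' => /(_ isT).
- apply/negbTE/negP => /noncube_twist; rewrite cv => /(_ isT)/twist_cube.
  by rewrite cv cv' => /(_ isT).
apply/idP/eqP => [/noncube_twist|].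
  rewrite cv => /(_ isT) tw; have [-> ->] := GH_twist_ratioE tw.
  case: ifP => // _; do 2!congr inr; case: tw => c [c0 _ ->].
  rewrite exprMn -exprM (_ : (3 * m)%N = #|F|.-1); last by rewrite card3m addn1.
  by rewrite expf_card_pred // mul1r.
case: (eqVneq u 0) => [u0|u0]; case: (eqVneq u' 0) => [u'0|u'0] // [e]; last first.
  by apply/GH_twist_wiso/GH_twist_ratio.
apply: GH_twist_wiso; have : is_cube (v / v').
  rewrite -expf_third_eq1 ?mulf_neq0 ?invr_eq0 // expr_div_n e divff //.
  by rewrite expf_neq0.
case/existsP=> c /eqP ec; exists c; rewrite u0 u'0 mulr0 -ec divfK //; split=> //.
by rewrite -[c == 0](expf_eq0 _ 3) -ec mulf_neq0 ?invr_eq0.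
Qed.

Lemma card_sum_set (X Y : finType) (D : {set X + Y}) :
  #|D| = (#|[set x | inl x \in D]| + #|[set y | inr y \in D]|)%N.
Proof.
rewrite -!sum1_card big_sumType /=.
by congr (_ + _)%N; apply: eq_bigl => z; rewrite inE.
Qed.

Lemma I_GH_mod1 : I_GH F = ((3 * (#|F| + 3)) %/ 4)%N.
Proof.
have [w w2] := exists_omega q1.
have F27 : 27%:R != 0 :> F by rewrite (_ : 27 = 3 ^ 3)%N // natrX expf_neq0.
rewrite /I_GH (card_classes GH_isoE) card_sum_set.
set D := _ @: GH_params F.
have -> : #|[set y | inr y \in D]| = (2 * m + 2)%N.
  rewrite card_sum_set -card_noncubes -card_cubic_characters.
  congr addn; apply: eq_card => z; rewrite !inE.
    apply/imsetP/idP => [[[u v]]|ncz].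
      rewrite inE /GH_class /= => /andP[v0 _]; case: ifP => // ncv.
      case: ifP => // u0 [->]; apply: contraFN ncv => /existsP[b /eqP e].
      have -> : v = (b * u) ^+ 3 by rewrite exprMn -e divfK // expf_neq0 // u0.
      exact: cube_is_cube.
    exists (1, z); last by rewrite /GH_class /= (negPf ncz) oner_eq0 expr1n divr1.
    rewrite inE /= expr1n; apply/andP; split.
      by apply: contraNneq ncz => ->; apply/existsP; exists 0; rewrite expr0n.
    (* A singular [(1, z)] would have [z = 1 / 27], a cube. *)
    apply: contraNneq ncz => e; apply/existsP; exists 3%:R^-1.
    apply/eqP/(mulfI F27); rewrite -e (_ : 27%:R = 3%:R ^+ 3); last by ring.
    by rewrite -exprMn divff // expr1n.
  apply/imsetP/imsetP => [[[u v]]|[v]].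
    rewrite inE /GH_class /= => /andP[v0 _]; case: ifP => // ncv.
    by case: ifP => // _ [->]; exists v; rewrite // inE ncv.
  rewrite inE => ncv ->; exists (0, v); last by rewrite /GH_class /= (negPf ncv) eqxx.
  have v0 : v != 0 by apply: contraNneq ncv => ->; apply/existsP; exists 0; rewrite expr0n.
  by rewrite inE /= v0 expr0n eq_sym mulf_neq0.
have -> : [set x | inl x \in D] = [set 27%:R * y | y in [set hess_j x | x in hess_smooth F]].
  apply/setP=> z; rewrite inE; apply/imsetP/imsetP => [[[u v]]|[_ /imsetP[x xs ->] ->]].
    rewrite inE /GH_class /= => /andP[v0 us]; case: ifP => // /existsP[b /eqP eb] [->].
    have b0 : b != 0 by rewrite -[b == 0](expf_eq0 _ 3) -eb.
    have eu : u = 3%:R * (u / (3%:R * b)) * b by field; rewrite b0 F3.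
    have x1 : (u / (3%:R * b)) ^+ 3 != 1.
      apply: contraNneq us => e; apply/eqP.
      transitivity (27%:R * (u / (3%:R * b)) ^+ 3 * b ^+ 3); last by rewrite e mulr1 -eb.
      by field; rewrite b0 F3.
    exists (hess_j (u / (3%:R * b))); first by apply: imset_f; rewrite inE.
    by rewrite {1}eu eb GH_j_hess.
  rewrite inE in xs; exists (3%:R * x, 1).
    rewrite inE /= oner_eq0 exprMn mulr1; apply: contraNneq xs => e.
    by apply/eqP/(mulfI F27); rewrite mulr1 -{2}e; ring.
  have := GH_j_hess F3 (oner_neq0 F) xs; rewrite expr1n mulr1 /GH_class /= => ->.
  by rewrite -[X in is_cube X](expr1n F 3) cube_is_cube.
rewrite card_imset; last exact: mulfI.
(* Adding [2 m + 2] to the number of j-values gives [9 k + 5], [9 k + 7] and [9 k + 12] in the three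
   cases, which are the values of the floor. *)
by have [k [[e ->]|[e ->]|[e ->]]] := card_hess_j_image w2 F3; move: card3m; rewrite e; lia.
Qed.

End ThreeTorsion.

Theorem mainTheorem16 (F : finFieldType) :
  I_GH F = (if #|F| %% 3 == 1 then (3 * (#|F| + 3)) %/ 4 else #|F| - 1)%N.
Proof.
case: eqP => [|q1]; first exact: I_GH_mod1.
have [q0|q2] : (#|F| %% 3 = 0 \/ #|F| %% 3 = 2)%N by lia.
  exact: I_GH_mod0.
exact: I_GH_mod2.
Qed.
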